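(* Let $m\ne0$ be real and let $\mathfrak s$ be any of the six solvable Lie algebras (A)--(F) listed in the context, with simply connected Lie group $S$, nilpotent ideal $\mathfrak n=\mathrm{span}\{e_1,\dots,e_6\}$, and Ricci-flat metric $g=e^{-2mt}\sum_{i=1}^7(e^i)^2$ on $S$, where $e^7=dt$. Then $g$ can be obtained by evolving the $SU(3)$ structure of the corresponding $2$-step nilmanifold $\Gamma\backslash N$. That is, there are an open interval $I\ni0$ and a one-parameter family $(\omega(T),\psi^+(T))$, $T\in I$, of invariant $SU(3)$ structures on $\Gamma\backslash N$ (equivalently, left-invariant on the simply connected group $N$ with Lie algebra $\mathfrak n$), with induced metrics $h(T)$ and associated forms $\psi^-(T)$, starting at $T=0$ from $$\omega(0)=e^{14}-e^{23}+e^{56},\qquad \psi^+(0)=e^{125}-e^{345}+e^{136}+e^{246},$$ satisfying $$\hat d\omega=\frac{\partial\psi^+}{\partial T},\qquad \hat d\psi^-=-\omega\wedge\frac{\partial\omega}{\partial T},$$ and such that the metric $h(T)+dT^2$ on $N\times I$ is isometric to $(S,g)$.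
   Context: Notation: $e^{ij\dots}=e^i\wedge e^j\wedge\cdots$. A tuple $(\beta_1,\dots,\beta_7)$ denotes the Lie algebra $\mathfrak s$ whose dual has a basis $e^1,\dots,e^7$ with Chevalley--Eilenberg differentials $de^i=\beta_i$ ($d\alpha(X,Y)=-\alpha([X,Y])$). The algebras are: (A) $(-\tfrac23me^{17},-me^{27},-\tfrac43me^{37}+\tfrac23me^{15},-me^{47},-\tfrac23me^{57},-me^{67},0)$; (B) $(-\tfrac34me^{17},-me^{27},-\tfrac32me^{37}+\tfrac12m(e^{15}-e^{46}),-\tfrac34me^{47},-\tfrac34me^{57},-\tfrac34me^{67},0)$; (C) $(-\tfrac45me^{17},-\tfrac65me^{27}-\tfrac25me^{45},-\tfrac75me^{37}+\tfrac25m(e^{15}-e^{46}),-\tfrac35me^{47},-\tfrac35me^{57},-\tfrac45me^{67},0)$; (D) $(-me^{17},-\tfrac54me^{27}-\tfrac12me^{45},-\tfrac54me^{37}-\tfrac12me^{46},-\tfrac12me^{47},-\tfrac34me^{57},-\tfrac34me^{67},0)$; (E) $(-\tfrac23me^{17},-\tfrac43me^{27}-\tfrac13m(e^{16}+e^{45}),-\tfrac43me^{37}+\tfrac13m(e^{15}-e^{46}),-\tfrac23me^{47},-\tfrac23me^{57},-\tfrac23me^{67},0)$; (F) $(-\tfrac35me^{17},-\tfrac35me^{27},-\tfrac65me^{37}+\tfrac25me^{15},-\tfrac65me^{47}+\tfrac25me^{25},-\tfrac35me^{57},-\tfrac65me^{67}+\tfrac25me^{12},0)$. The ideal $\mathfrak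 n$ is $2$-step nilpotent; its structure equations are obtained by dropping the terms containing $e^7$. $\hat d$ denotes the Chevalley--Eilenberg differential of $\mathfrak n$ (the exterior derivative on $N$ of left-invariant forms), $N$ is the simply connected group with Lie algebra $\mathfrak n$, and $\Gamma\subset N$ is a discrete cocompact subgroup. On $S\cong\mathbb R^7$ the closed form $e^7$ is exact, and $t$ is a global function with $e^7=dt$. An invariant $SU(3)$ structure on $N$ is a pair $(\omega,\psi^+)$ of left-invariant forms for which there is a basis $f^1,\dots,f^6$ of $\mathfrak n^*$ with $\omega=f^{14}-f^{23}+f^{56}$ and $\psi^++i\psi^-=(f^1+if^4)\wedge(f^2-if^3)\wedge(f^5+if^6)$; this also defines $\psi^-$ and the induced metric $h=\sum_i(f^i)^2$. *)

(* Defs.v *)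
From HB Require Import structures.
From mathcomp Require Import all_boot all_order perm all_algebra.
From mathcomp Require Import all_classical all_reals all_analysis.
From mathcomp Require Import complex.

Set Implicit Arguments.
Unset Strict Implicit.
Unset Printing Implicit Defensive.

Import Order.TTheory GRing.Theory Num.Theory.
Import numFieldNormedType.Exports.

Local Open Scope classical_set_scope.
Local Open Scope ring_scope.

(* A k-form on R^n is evaluated on the k rows of a (k, n) matrix. *)
Notation kform R n k := ('M[R]_(k, n) -> R^o) (only parsing).

(* For a coframe f of R^n, stored as the matrix whose i-th column is f^i,
   [wedge1 f [:: i1; ...; ik]] is f^{i1} /\ ... /\ f^{ik}; as usual the
   indices i1, ..., ik start at 1. *)
Definition wedge1 (R : realType) (n : nat) (f : 'M[R]_n.+1) (s : seq nat) :
    kform R n.+1 (size s) :=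
  fun M => \det (\matrix_(r, c) (M *m f) r (inord (nth 0%N s c).-1)).
Arguments wedge1 {R n} f s%_N _.

Definition wedge (R : realType) (n p q : nat) (a : kform R n p) (b : kform R n q) :
    kform R n (p + q) :=
  fun M => (\sum_(s : 'S_(p + q))
    (-1) ^+ s * (a (usubmx (row_perm s M)) * b (dsubmx (row_perm s M))))
    / (p`! * q`!)%:R.

(* The bracket on R^n determined by e^i([X, Y]) = - beta_i(X, Y). *)
Definition bracket (R : realType) (n : nat) (beta : n.-tuple (kform R n 2))
    (X Y : 'rV[R]_n) : 'rV[R]_n :=
  \row_i - tnth beta i (col_mx X Y).

(* (da)(X_0, ..., X_k.+1) is the sum over i < j of
   (-1)^(i+j) a([X_i, X_j], X_0, .., ^X_i, .., ^X_j, .., X_k.+1);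
   the second index is written lift i j. *)
Definition ce_diff (R : realType) (n k : nat)
    (br : 'rV[R]_n -> 'rV[R]_n -> 'rV[R]_n) (a : kform R n k.+1) :
    kform R n k.+2 :=
  fun M => \sum_(i < k.+2) \sum_(j < k.+1 | (i < lift i j)%N)
    (-1) ^+ (i + lift i j) *
    a (col_mx (br (row i M) (row (lift i j) M)) (row' j (row' i M))).

Inductive label := alg_A | alg_B | alg_C | alg_D | alg_E | alg_F.

Section Algebras.
Variables (R : realType) (m : R).

Local Notation e s := (wedge1 (1%:M : 'M[R]_7) s).

(* The differentials (de^1, ..., de^7). *)
Definition structure_eqs (a : label) : 7.-tuple (kform R 7 2) :=
  match a with
  | alg_A => [tuple
      - (2 / 3 * m) *: e [:: 1; 7];
      - m *: e [:: 2; 7];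
      - (4 / 3 * m) *: e [:: 3; 7] + (2 / 3 * m) *: e [:: 1; 5];
      - m *: e [:: 4; 7];
      - (2 / 3 * m) *: e [:: 5; 7];
      - m *: e [:: 6; 7];
      0]
  | alg_B => [tuple
      - (3 / 4 * m) *: e [:: 1; 7];
      - m *: e [:: 2; 7];
      - (3 / 2 * m) *: e [:: 3; 7]
        + (1 / 2 * m) *: (e [:: 1; 5] - e [:: 4; 6]);
      - (3 / 4 * m) *: e [:: 4; 7];
      - (3 / 4 * m) *: e [:: 5; 7];
      - (3 / 4 * m) *: e [:: 6; 7];
      0]
  | alg_C => [tuple
      - (4 / 5 * m) *: e [:: 1; 7];
      - (6 / 5 * m) *: e [:: 2; 7] - (2 / 5 * m) *: e [:: 4; 5];
      - (7 / 5 * m) *: e [:: 3; 7]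
        + (2 / 5 * m) *: (e [:: 1; 5] - e [:: 4; 6]);
      - (3 / 5 * m) *: e [:: 4; 7];
      - (3 / 5 * m) *: e [:: 5; 7];
      - (4 / 5 * m) *: e [:: 6; 7];
      0]
  | alg_D => [tuple
      - m *: e [:: 1; 7];
      - (5 / 4 * m) *: e [:: 2; 7] - (1 / 2 * m) *: e [:: 4; 5];
      - (5 / 4 * m) *: e [:: 3; 7] - (1 / 2 * m) *: e [:: 4; 6];
      - (1 / 2 * m) *: e [:: 4; 7];
      - (3 / 4 * m) *: e [:: 5; 7];
      - (3 / 4 * m) *: e [:: 6; 7];
      0]
  | alg_E => [tuple
      - (2 / 3 * m) *: e [:: 1; 7];
      - (4 / 3 * m) *: e [:: 2; 7]
        - (1 / 3 * m) *: (e [:: 1; 6] + e [:: 4; 5]);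
      - (4 / 3 * m) *: e [:: 3; 7]
        + (1 / 3 * m) *: (e [:: 1; 5] - e [:: 4; 6]);
      - (2 / 3 * m) *: e [:: 4; 7];
      - (2 / 3 * m) *: e [:: 5; 7];
      - (2 / 3 * m) *: e [:: 6; 7];
      0]
  | alg_F => [tuple
      - (3 / 5 * m) *: e [:: 1; 7];
      - (3 / 5 * m) *: e [:: 2; 7];
      - (6 / 5 * m) *: e [:: 3; 7] + (2 / 5 * m) *: e [:: 1; 5];
      - (6 / 5 * m) *: e [:: 4; 7] + (2 / 5 * m) *: e [:: 2; 5];
      - (3 / 5 * m) *: e [:: 5; 7];
      - (6 / 5 * m) *: e [:: 6; 7] + (2 / 5 * m) *: e [:: 1; 2];
      0]
  end.

Variable a : label.

Definition s_bracket : 'rV[R]_7 -> 'rV[R]_7 -> 'rV[R]_7 :=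
  bracket (structure_eqs a).

(* n = span{e_1, ..., e_6}: restricting to n kills e^7. *)
Definition n_bracket (X Y : 'rV[R]_6) : 'rV[R]_6 :=
  @lsubmx R 1 6 1 (s_bracket (row_mx X (0 : 'rV[R]_1)) (row_mx Y (0 : 'rV[R]_1))).

(* N is n itself with the Baker-Campbell-Hausdorff product, which stops at the
   first bracket because n is 2-step nilpotent. *)
Definition n_mul (x y : 'rV[R]_6) : 'rV[R]_6 := x + y + 2^-1 *: n_bracket x y.

Definition n_inv (x : 'rV[R]_6) : 'rV[R]_6 := - x.

(* In all six algebras ad(e_7) is diagonal on n in the basis e_1, ..., e_6. *)
Definition weight (i : 'I_6) : R :=
  s_bracket (delta_mx 0 ord_max) (delta_mx 0 (lshift 1 i)) 0 (lshift 1 i).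

Definition exp_ad (s : R) (x : 'rV[R]_6) : 'rV[R]_6 :=
  \row_i (expR (s * weight i) * x 0 i).

Definition spair (x : 'rV[R]_6) (s : R) : 'rV[R]_7 := row_mx x (s%:M : 'rV[R]_1).
Definition npart (p : 'rV[R]_7) : 'rV[R]_6 := @lsubmx R 1 6 1 p.
Definition tpart (p : 'rV[R]_7) : R := p 0 ord_max.

(* S is the semidirect product of N and R, where s in R acts on N by the
   automorphism exp(s ad(e_7)). *)
Definition s_mul (p q : 'rV[R]_7) : 'rV[R]_7 :=
  spair (n_mul (npart p) (exp_ad (tpart p) (npart q))) (tpart p + tpart q).

Definition s_inv (p : 'rV[R]_7) : 'rV[R]_7 :=
  spair (exp_ad (- tpart p) (n_inv (npart p))) (- tpart p).

End Algebras.

(* The left Maurer-Cartan form d(L_{p^-1})_p, which sends a tangent vector at p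
   to the Lie algebra; the unit element is always the origin here. *)
Definition maurer_cartan (R : realType) (V : normedModType R)
    (mul : V -> V -> V) (inv : V -> V) (p : V) : V -> V :=
  'd (mul (inv p)) p.

Section Metrics.
Variables (R : realType) (m : R) (a : label).

Definition theta_N := maurer_cartan (n_mul m a) (@n_inv R).
Definition theta_S := maurer_cartan (s_mul m a) (s_inv m a).

(* t is a primitive of the left-invariant form e^7. *)
Definition primitive_e7 (t : 'rV[R]_7 -> R^o) : Prop :=
  forall p, differentiable t p /\
            forall v, 'd t p v = theta_S p v 0 ord_max.

Definition metric_S (t : 'rV[R]_7 -> R^o) (p u v : 'rV[R]_7) : R :=
  expR (- 2 * m * t p) * \sum_i theta_S p u 0 i * theta_S p v 0 i.

(* h(T) + dT^2 at the point (x, T) of N x R. *)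
Definition metric_NI (h : R -> 'rV[R]_6 -> 'rV[R]_6 -> R)
    (p u v : 'rV[R]_6 * R^o) : R :=
  h p.2 (theta_N p.1 u.1) (theta_N p.1 v.1) + u.2 * v.2.

End Metrics.

(* psi^+ + i psi^- is the decomposable complex 3-form with factors
   f^1 + i f^4, f^2 - i f^3 and f^5 + i f^6. *)
Definition su3_structure (R : realType) (omega : kform R 6 2)
    (psip psim : kform R 6 3) (h : 'rV[R]_6 -> 'rV[R]_6 -> R) : Prop :=
  exists2 f : 'M[R]_6, f \in unitmx &
    [/\ omega = wedge1 f [:: 1; 4] - wedge1 f [:: 2; 3] + wedge1 f [:: 5; 6],
        forall M : 'M[R]_(3, 6),
          Complex (psip M) (psim M) =
          \det (\matrix_(r < 3, c < 3)
            let v i := (M *m f) r (inord i.-1) in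
            nth 0 [:: Complex (v 1%N) (v 4%N);
                      Complex (v 2%N) (- v 3%N);
                      Complex (v 5%N) (v 6%N)] c)
      & forall X Y, h X Y = \sum_i (X *m f) 0 i * (Y *m f) 0 i].

Section Smooth.
Variables (R : realType) (V W : normedModType R).

(* C^k on an open subset U of V; V is finite-dimensional in all uses. *)
Fixpoint Ck (k : nat) (U : set V) (f : V -> W) : Prop :=
  match k with
  | 0 => forall x, U x -> {for x, continuous f}
  | k'.+1 => (forall x, U x -> differentiable f x) /\
             forall v, Ck k' U (fun x => 'D_v f x)
  end.

Definition smooth (U : set V) (f : V -> W) : Prop := forall k, Ck k U f.

End Smooth.

Definition isometric (R : realType) (V W : normedModType R)
    (U : set V) (gU : V -> V -> V -> R)
    (U' : set W) (gU' : W -> W -> W -> R) : Prop :=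
  exists (phi : V -> W) (phi' : W -> V),
    [/\ smooth U phi /\ smooth U' phi',
        forall p, U p -> U' (phi p) /\ phi' (phi p) = p,
        forall q, U' q -> U (phi' q) /\ phi (phi' q) = q
      & forall p u v, U p -> gU' (phi p) ('d phi p u) ('d phi p v) = gU p u v].

(* Main.v *)
Require Import Defs.
From HB Require Import structures.
From mathcomp Require Import all_boot all_order all_algebra.
From mathcomp Require Import all_classical all_reals all_analysis.
From mathcomp Require Import perm complex ring lra zify.

Set Implicit Arguments.
Unset Strict Implicit.
Unset Printing Implicit Defensive.

Import Order.TTheory GRing.Theory Num.Theory.
Import numFieldNormedType.Exports.

Local Open Scope classical_set_scope.
Local Open Scope ring_scope.

(* Put u = 1 - m T.  If de^i = - m (1 - a_i) e^i7 + ..., then rescaling the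
   standard coframe of n to f^i = u^(a_i) e^i solves the flow: every term of the
   two evolution equations is a power of u times a basis form, and both the
   exponents and the coefficients match in each of the six algebras.  The
   substitution u = exp(- m t) turns sum_i (f^i)^2 + dT^2 into
   exp(- 2 m t) (sum_i exp(2 m (1 - a_i) t) (e^i)^2 + dt^2), with e^i left
   invariant on N; this is g in the coordinates of the semidirect product.  A
   primitive t of e^7 is the last coordinate up to a constant c, and this
   constant is absorbed by left translation by exp(- c e_7), acting on N as the
   automorphism exp(- c ad(e_7)). *)

(** * Calculus of [Ck] maps and of differentials between normed spaces *)

Section Smoothness.
Variables (R : realType) (V W : normedModType R).
Implicit Types (U : set V) (f g : V -> W).

(** Differentiability at [x] is a property of the germ: [g - f] vanishes near [x], so it expands
    there with zero differential, and [g] is the sum of [f] and this difference. *)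
Lemma near_differentiable f g x :
  {near x, f =1 g} -> differentiable f x -> differentiable g x.
Proof.
move=> fg df.
have -> : g = f + (g - f) by rewrite addrC subrK.
apply: differentiableD => //; set h := g - f.
have h0 : \forall y \near x, h y = 0.
  by near=> y; rewrite /h !fctE (near fg y)// subrr.
have hE : h \o shift x = cst (h x) + \0 +o_ 0 id.
  apply/eqaddoE; rewrite addr0 (nbhs_singleton h0) funeqE => y /=.
  rewrite -[LHS]add0r; congr (_ + _).
  rewrite littleoE // => _/posnumP[e].
  have h0' : \forall z \near 0, h (z + x) = 0.
    by move: h0; rewrite (near_shift 0 x) subr0.
  near=> z; rewrite /= (_ : h (z + x) = 0) ?normr0 ?mulr_ge0//.
  by near: z.
(* By uniqueness the differential of [h] at [x] is zero, so [hE] is the expansion that defines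
   differentiability. *)
have /= dh := @diff_unique _ _ _ h \0 x (@cst_continuous _ _ 0) hE.
apply/diff_locallyP; rewrite dh; split => //.
exact: cst_continuous.
Unshelve. all: by end_near. Qed.

(** Openness of [U] turns equality on [U] into equality near each of its points, which is what
    derivatives see. Formulas valid only on [U] thus become usable in inductions on [k]. *)
Lemma Ck_eq k U f g : open U -> (forall x, U x -> f x = g x) ->
  Ck k U f -> Ck k U g.
Proof.
move=> oU; elim: k f g => [|k IH] f g fg.
  move=> /= cf x Ux; have fg' : {near x, f =1 g}.
    by apply: filterS (open_nbhs_nbhs (conj oU Ux)) => y; exact: fg.
  have cfx : f @ x --> f x by exact: cf.
  suff : g @ x --> g x by [].
  by rewrite -(fg _ Ux); apply: cvg_trans cfx; exact: near_eq_cvg.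
move=> [df ckf]; split=> [x Ux|v].
  apply: near_differentiable (df _ Ux).
  by apply: filterS (open_nbhs_nbhs (conj oU Ux)) => y; exact: fg.
apply: IH (ckf v) => x Ux; apply: near_eq_derive.
by apply: filterS (open_nbhs_nbhs (conj oU Ux)) => y; exact: fg.
Qed.

Lemma Ck_cst k U (w : W) : Ck k U (cst w : V -> W).
Proof.
elim: k w => [w x _|k IH w] /=; first exact: cst_continuous.
split=> [x _|v]; first exact: differentiable_cst.
rewrite (_ : (fun x => _) = cst 0) //.
by apply/funext => x; rewrite derive_cst.
Qed.

Lemma Ck_add k U f g : open U -> Ck k U f -> Ck k U g -> Ck k U (f + g).
Proof.
move=> oU; elim: k f g => [|k IH] f g /=.
  by move=> cf cg x Ux; apply: cvgD; [exact: cf|exact: cg].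
move=> [df ckf] [dg ckg]; split=> [x Ux|v].
  by apply: differentiableD; [exact: df|exact: dg].
apply: Ck_eq (IH _ _ (ckf v) (ckg v)) => // x Ux.
by rewrite deriveD //; apply: diff_derivable; [exact: df|exact: dg].
Qed.

Lemma Ck_opp k U f : open U -> Ck k U f -> Ck k U (- f).
Proof.
move=> oU; elim: k f => [|k IH] f /=.
  by move=> cf x Ux; apply: continuousN; exact: cf.
move=> [df ckf]; split=> [x Ux|v]; first exact/differentiableN/df.
apply: Ck_eq (IH _ (ckf v)) => // x Ux.
by rewrite deriveN //; apply: diff_derivable; exact: df.
Qed.

Lemma linear_Ck k U (L : {linear V -> W}) : continuous L -> Ck k U L.
Proof.
case: k => [cL x _|k cL] /=; first exact: cL.
split=> [x _|v]; first exact: linear_differentiable.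
rewrite (_ : (fun x => _) = cst (L v)); first exact: Ck_cst.
by apply/funext => x; rewrite deriveE ?diff_lin//; exact: linear_differentiable.
Qed.

Lemma is_diff_scalar_comp (D : R -> R) (d : R) (l : {linear V -> R^o})
    (w : W) x :
  continuous l -> is_derive (l x) 1 D d ->
  is_diff x (fun x => D (l x) *: w) (fun v => (d * l v) *: w).
Proof.
move=> cl [dD eD].
have dDl : differentiable (D : R^o -> R^o) (l x) by exact/derivable1_diffP.
have dl : differentiable l x by exact: linear_differentiable.
apply: DiffDef; first exact: differentiableZl (differentiable_comp dl dDl).
rewrite diffZl; last exact: differentiable_comp.
apply/funext => v; rewrite diff_comp //= diff1E// derive1E eD diff_lin//.
by rewrite mulrC.
Qed.

(** [D n] is the [n]-th derivative of [D 0%N]. The derivative of [D n (l x) *: w] along [v] is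
    [D n.+1 (l x) *: (l v *: w)], a map of the same shape, so smoothness of a one-variable profile
    passes to normed spaces. *)
Lemma Ck_scalar_comp (D : nat -> R -> R) (J : set R) k U
    (l : {linear V -> R^o}) (w : W) : open U -> continuous l ->
  (forall n r, J r -> is_derive r 1 (D n) (D n.+1 r)) ->
  (forall x, U x -> J (l x)) -> Ck k U (fun x => D 0%N (l x) *: w).
Proof.
move=> oU cl dD UJ.
have dl n (z : W) x : U x ->
    is_diff x (fun x => D n (l x) *: z) (fun v => (D n.+1 (l x) * l v) *: z).
  by move=> Ux; apply: is_diff_scalar_comp => //; exact/dD/UJ.
(* Each differentiation changes the order and the vector, so both are generalized before the
   induction on [k]. *)
move: 0%N w; elim: k => [|k IH] n z.
  by move=> x Ux; apply: differentiable_continuous; case: (dl n z x Ux).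
split=> [x Ux|v]; first by case: (dl n z x Ux).
apply: Ck_eq (IH n.+1 (l v *: z)) => // x Ux.
by case: (dl n z x Ux) => dx ex; rewrite deriveE// ex scalerA.
Qed.

(** Left translations of [N] and [S] are affine in the chosen coordinates; this lemma yields their
    differentials, hence the Maurer-Cartan forms. *)
Lemma affine_diff (L : {linear V -> W}) f b : continuous L ->
  (forall x, f x = L x + b) -> forall x, is_diff x f L.
Proof.
move=> cL fL x; have -> : f = (L : V -> W) + cst b by apply/funext.
have dL : is_diff x L L.
  by apply: DiffDef; [exact: linear_differentiable|rewrite diff_lin].
by apply: is_diff_eq; rewrite addr0.
Qed.

End Smoothness.

Lemma linear_rV_continuous (R : realType) n (W : normedModType R)
  (L : {linear 'rV[R]_n -> W}) : continuous L.
Proof.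
have -> : (L : 'rV[R]_n -> W) =
    fun x => \sum_(i < n) x 0 i *: L (delta_mx 0 i).
  apply/funext => x; rewrite {1}[x]row_sum_delta linear_sum.
  by apply: eq_bigr => i _; rewrite linearZ.
apply: continuous_big => [|i _]; first exact: add_continuous.
move=> x; have cx : (fun y : 'rV[R]_n => y 0 i) @ x --> x 0 i.
  exact: coord_continuous.
exact: cvgZr_tmp cx.
Qed.

(** * The scale u = 1 - m T, and the derivatives of u^p, ln u and exp(- m s) *)

Section Profiles.
Variables (R : realType) (m : R).

(** The time interval of the flow, where u stays positive; for [m] nonzero it is a half-line with
    endpoint 1/m. *)
Definition dom : set R := [set T | 0 < 1 - m * T].

Lemma open_dom : open dom.
Proof.
have -> : dom = (fun T => 1 - m * T) @^-1` [set x | 0 < x] by [].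
apply: open_comp; last exact: open_gt.
move=> T _; apply: continuousB; first exact: cst_continuous.
exact: mulrl_continuous.
Qed.

Lemma is_interval_dom : is_interval dom.
Proof.
move=> x y; rewrite /dom /= => ux uy z /andP[xz zy].
(* The sign of [m] decides which of [x] and [y] bounds [1 - m * z] from below. *)
case: (lerP 0 m) => m0; first by nra.
by nra.
Qed.

Lemma is_derive_affine (T : R) : is_derive T 1 (fun T : R => 1 - m * T) (- m).
Proof.
have -> : (fun T : R => 1 - m * T) = cst 1 - m *: (id : R -> R) by [].
by apply: is_derive_eq; rewrite sub0r [_ *: _]mulr1.
Qed.

Lemma is_derive_pow p (T : R) : dom T ->
  is_derive T 1 (fun T : R => (1 - m * T) `^ p)
    (- (m * p) * (1 - m * T) `^ (p - 1)).
Proof.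
move=> uT.
have -> : (fun T : R => (1 - m * T) `^ p) =
  ((@powR R) ^~ p) \o (fun T : R => 1 - m * T) by [].
have dp : is_derive (1 - m * T) 1 ((@powR R) ^~ p) (p * (1 - m * T) `^ (p - 1)).
  exact: is_derive1_powR.
have da := is_derive_affine T.
by apply: is_derive_eq; ring.
Qed.

(** The [n]-th derivative of u^p in T. *)
Definition pow_derivs p n (T : R) : R :=
  \prod_(i < n) (- (m * (p - i%:R))) * (1 - m * T) `^ (p - n%:R).

Lemma is_derive_pow_derivs p n (T : R) : dom T ->
  is_derive T 1 (pow_derivs p n) (pow_derivs p n.+1 T).
Proof.
move=> uT; have dp := is_derive_pow (p - n%:R) uT.
rewrite /pow_derivs big_ord_recr /=.
set c := \prod_(i < n) _.
have -> : (fun T => c * (1 - m * T) `^ (p - n%:R)) =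
  c *: (fun T : R => (1 - m * T) `^ (p - n%:R)) by [].
apply: is_derive_eq; rewrite [_ *: _]mulrA -natr1 opprD addrA.
by congr (_ * _); rewrite mulrC; ring.
Qed.

(** The first derivative of ln u is - m u^(-1), so the higher ones come from the power family with
    exponent -1. *)
Definition log_derivs n (T : R) : R :=
  if n is n'.+1 then - m * pow_derivs (-1) n' T else ln (1 - m * T).

Lemma is_derive_log_derivs n (T : R) : dom T ->
  is_derive T 1 (log_derivs n) (log_derivs n.+1 T).
Proof.
case: n => [|n] uT.
  have -> : log_derivs 0%N = (@ln R) \o (fun T : R => 1 - m * T) by [].
  have dp : is_derive (1 - m * T) 1 (@ln R) (1 - m * T)^-1.
    exact: is_derive1_ln.
  have da := is_derive_affine T.
  apply: is_derive_eq; rewrite /log_derivs /pow_derivs big_ord0 mul1r subr0.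
  by rewrite powR_inv1 ?ltW// mulrC.
have dp := is_derive_pow_derivs (-1) n uT.
have -> : log_derivs n.+1 = - m *: pow_derivs (-1) n by [].
exact: is_derive_eq.
Qed.

Definition exp_derivs n (s : R) : R := (- m) ^+ n * expR (- m * s).

Lemma is_derive_exp_derivs n (s : R) :
  is_derive s 1 (exp_derivs n) (exp_derivs n.+1 s).
Proof.
have -> : exp_derivs n = (- m) ^+ n *: ((@expR R) \o (fun s => - m * s)) by [].
have dl : is_derive s 1 (fun s : R => - m * s) (- m).
  have -> : (fun s : R => - m * s) = - m *: (id : R -> R) by [].
  by apply: is_derive_eq; rewrite [_ *: _]mulr1.
apply: is_derive_eq; rewrite /exp_derivs exprSr [_ *: _]mulrA.
by rewrite -!mulrA [expR _ * _]mulrC.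
Qed.

End Profiles.

(** * Explicit determinants of size at most 4 *)

Section Determinants.
Variable R : comPzRingType.

(** Entries come from a function on [nat], so that each minor is again of this kind, with columns
    reindexed by [bump]; the expansion can then be iterated. *)
Lemma det_expand_nat n (F : nat -> nat -> R) :
  \det (\matrix_(r < n.+1, c < n.+1) F r c) =
  \sum_(j < n.+1) F 0%N j * ((-1) ^+ j *
    \det (\matrix_(r < n, c < n) F r.+1 (bump j c))).
Proof.
rewrite (expand_det_row _ ord0); apply: eq_bigr => j _.
rewrite mxE /cofactor add0n; congr (_ * (_ * \det _)).
by apply/matrixP => r c; rewrite !mxE.
Qed.

Lemma det2_nat (F : nat -> nat -> R) :
  \det (\matrix_(r < 2, c < 2) F r c) =
  F 0%N 0%N * F 1%N 1%N - F 0%N 1%N * F 1%N 0%N.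
Proof.
rewrite det_expand_nat !big_ord_recl big_ord0 !det_mx11 !mxE /= /bump /=.
by ring.
Qed.

Lemma det3_nat (F : nat -> nat -> R) :
  \det (\matrix_(r < 3, c < 3) F r c) =
  F 0%N 0%N * (F 1%N 1%N * F 2%N 2%N - F 1%N 2%N * F 2%N 1%N) -
  F 0%N 1%N * (F 1%N 0%N * F 2%N 2%N - F 1%N 2%N * F 2%N 0%N) +
  F 0%N 2%N * (F 1%N 0%N * F 2%N 1%N - F 1%N 1%N * F 2%N 0%N).
Proof.
rewrite det_expand_nat !big_ord_recl big_ord0.
rewrite !(det2_nat (fun r c => F r.+1 (bump _ c))) /= /bump /=.
by ring.
Qed.

Lemma det4_nat (F : nat -> nat -> R) (m3 := fun i j k =>
    F 1%N i * (F 2%N j * F 3%N k - F 2%N k * F 3%N j) -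
    F 1%N j * (F 2%N i * F 3%N k - F 2%N k * F 3%N i) +
    F 1%N k * (F 2%N i * F 3%N j - F 2%N j * F 3%N i)) :
  \det (\matrix_(r < 4, c < 4) F r c) =
  F 0%N 0%N * m3 1%N 2%N 3%N - F 0%N 1%N * m3 0%N 2%N 3%N +
  F 0%N 2%N * m3 0%N 1%N 3%N - F 0%N 3%N * m3 0%N 1%N 2%N.
Proof.
rewrite det_expand_nat !big_ord_recl big_ord0 /m3.
rewrite !(det3_nat (fun r c => F r.+1 (bump _ c))) /= /bump /=.
by ring.
Qed.

End Determinants.

(** * Wedge products and the Chevalley-Eilenberg differential in coordinates *)

Section Forms.
Variables (R : realType) (n : nat).
Implicit Type f : 'M[R]_n.+1.

Lemma wedge1_2E f i j (M : 'M[R]_(2, n.+1))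
    (x := fun r c => (M *m f) (inord r) (inord c.-1)) :
  wedge1 f [:: i; j]%N M = x 0%N i * x 1%N j - x 0%N j * x 1%N i.
Proof.
rewrite -(det2_nat (fun r c => x r (nth 0%N [:: i; j] c))).
by congr (\det _); apply/matrixP => r c; rewrite !mxE /x mxE inord_val.
Qed.

Lemma wedge1_3E f i j k (M : 'M[R]_(3, n.+1))
    (x := fun r c => (M *m f) (inord r) (inord c.-1)) :
  wedge1 f [:: i; j; k]%N M =
  x 0%N i * (x 1%N j * x 2%N k - x 1%N k * x 2%N j) -
  x 0%N j * (x 1%N i * x 2%N k - x 1%N k * x 2%N i) +
  x 0%N k * (x 1%N i * x 2%N j - x 1%N j * x 2%N i).
Proof.
rewrite -(det3_nat (fun r c => x r (nth 0%N [:: i; j; k] c))).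
by congr (\det _); apply/matrixP => r c; rewrite !mxE /x mxE inord_val.
Qed.

Lemma wedge1_4E f i j k l (M : 'M[R]_(4, n.+1))
    (x := fun r c => (M *m f) (inord r) (inord c.-1))
    (m3 := fun i j k =>
      x 1%N i * (x 2%N j * x 3%N k - x 2%N k * x 3%N j) -
      x 1%N j * (x 2%N i * x 3%N k - x 2%N k * x 3%N i) +
      x 1%N k * (x 2%N i * x 3%N j - x 2%N j * x 3%N i)) :
  wedge1 f [:: i; j; k; l]%N M =
  x 0%N i * m3 j k l - x 0%N j * m3 i k l +
  x 0%N k * m3 i j l - x 0%N l * m3 i j k.
Proof.
rewrite -(det4_nat (fun r c => x r (nth 0%N [:: i; j; k; l] c))).
by congr (\det _); apply/matrixP => r c; rewrite !mxE /x mxE inord_val.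
Qed.

(** Each column of the minor is scaled by one diagonal entry of [d], so the minor is the unscaled
    one times a diagonal matrix. *)
Lemma wedge1_diag (d : 'rV[R]_n.+1) s M :
  wedge1 (diag_mx d) s M =
  (\prod_(i <- s) d 0 (inord i.-1)) * wedge1 1%:M s M.
Proof.
rewrite (big_nth 0%N) big_mkord mulrC /wedge1.
transitivity (\det ((\matrix_(r, c) (M *m (1%:M : 'M[R]_n.+1)) r
   (inord (nth 0%N s c).-1)) *m
   diag_mx (\row_(c < size s) d 0 (inord (nth 0%N s c).-1)))).
  congr (\det _); apply/matrixP => r c.
  by rewrite !mul_mx_diag mulmx1 !mxE.
rewrite det_mulmx det_diag; congr (_ * _).
by apply: eq_bigr => i _; rewrite mxE.
Qed.

(* Each of the four products of entries in the two 2-minors sums over S_4 to a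
   4 x 4 determinant with permuted columns, hence to the same value. *)
Lemma wedge_wedge1 f i j k l M :
  wedge (wedge1 f [:: i; j]%N) (wedge1 f [:: k; l]%N) M =
  wedge1 f [:: i; j; k; l]%N M.
Proof.
have leib i' j' k' l' : \sum_(s : 'S_4) (-1) ^+ s *
   ((M *m f) (s (inord 0)) (inord i'.-1) *
      (M *m f) (s (inord 1)) (inord j'.-1) *
    ((M *m f) (s (inord 2)) (inord k'.-1) *
      (M *m f) (s (inord 3)) (inord l'.-1))) = wedge1 f [:: i'; j'; k'; l']%N M.
  rewrite /wedge1; move: (M *m f) => y.
  (* Transposing moves the permutation to the row index, where [row_perm] puts it in [wedge]. *)
  rewrite -det_tr; apply: eq_bigr => s _; congr (_ * _).
  rewrite !big_ord_recl big_ord0 !mxE /= mulr1 !mulrA.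
  by congr (_ * _ * _ * _); congr (y (s _) _); apply: val_inj;
    rewrite /= ?inordK.
have swap i' j' k' l' : wedge1 f [:: i'; j'; l'; k']%N M =
    - wedge1 f [:: i'; j'; k'; l']%N M.
  by rewrite !wedge1_4E; ring.
have swap' i' j' k' l' : wedge1 f [:: j'; i'; k'; l']%N M =
    - wedge1 f [:: i'; j'; k'; l']%N M.
  by rewrite !wedge1_4E; ring.
rewrite /wedge.
transitivity ((wedge1 f [:: i; j; k; l]%N M - wedge1 f [:: i; j; l; k]%N M
   - wedge1 f [:: j; i; k; l]%N M + wedge1 f [:: j; i; l; k]%N M)
   / (2`! * 2`!)%:R); last first.
  rewrite (swap i j k l) (swap' i j k l) (swap' i j l k) (swap i j k l).
  by rewrite (_ : (2`! * 2`!)%N = 4%N) //; field.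
congr (_ / _); rewrite -!leib -!sumrB -big_split /=; apply: eq_bigr => s _.
rewrite !wedge1_2E.
have rowu (r : nat) c : (r < 2)%N ->
   (usubmx (row_perm s M) *m f) (inord r) c = (M *m f) (s (inord r)) c.
  move=> r2; rewrite !mxE; apply: eq_bigr => p _; rewrite !mxE.
  congr (M (s _) _ * _); apply: val_inj; rewrite /= !inordK//.
  by apply: leq_trans r2 _.
have rowd (r : nat) c : (r < 2)%N ->
   (dsubmx (row_perm s M) *m f) (inord r) c = (M *m f) (s (inord r.+2)) c.
  move=> r2; rewrite !mxE; apply: eq_bigr => p _; rewrite !mxE.
  by congr (M (s _) _ * _); apply: val_inj; rewrite /= !inordK.
rewrite !rowu // !rowd // {rowu rowd leib swap swap'}.
move: (M *m f) ((-1) ^+ s : R) => y e.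
by ring.
Qed.

Lemma wedgeDl p q (a b : kform R n p) (c : kform R n q) M :
  wedge (a + b) c M = wedge a c M + wedge b c M.
Proof.
rewrite /wedge -mulrDl -big_split /=; congr (_ / _); apply: eq_bigr => s _.
by move: ((-1) ^+ s : R) => e; rewrite fctE; ring.
Qed.

Lemma wedgeZl p q k (a : kform R n p) (c : kform R n q) M :
  wedge (k *: a) c M = k * wedge a c M.
Proof.
rewrite /wedge mulrA mulr_sumr; congr (_ / _); apply: eq_bigr => s _.
by move: ((-1) ^+ s : R) => e; rewrite fctE /GRing.scale /=; ring.
Qed.

Lemma wedgeDr p q (c : kform R n p) (a b : kform R n q) M :
  wedge c (a + b) M = wedge c a M + wedge c b M.
Proof.
rewrite /wedge -mulrDl -big_split /=; congr (_ / _); apply: eq_bigr => s _.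
by move: ((-1) ^+ s : R) => e; rewrite fctE; ring.
Qed.

Lemma wedgeZr p q k (c : kform R n p) (a : kform R n q) M :
  wedge c (k *: a) M = k * wedge c a M.
Proof.
rewrite /wedge mulrA mulr_sumr; congr (_ / _); apply: eq_bigr => s _.
by move: ((-1) ^+ s : R) => e; rewrite fctE /GRing.scale /=; ring.
Qed.

(** The pairs i < j are (0,1), (0,2) and (1,2), and (-1)^(i+j) gives them the signs -, +, -. *)
Lemma ce_diff2E br (a : kform R n 2) (M : 'M[R]_(3, n))
    (r := fun i => row (inord i) M) :
  ce_diff br a M = - a (col_mx (br (r 0%N) (r 1%N)) (r 2%N))
    + a (col_mx (br (r 0%N) (r 2%N)) (r 1%N))
    - a (col_mx (br (r 1%N) (r 2%N)) (r 0%N)).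
Proof.
have E0 : ord0 = inord 0 :> 'I_3 by apply/val_inj; rewrite /= inordK.
have E1 : lift ord0 ord0 = inord 1 :> 'I_3 by apply/val_inj; rewrite /= inordK.
have E2 : lift ord0 (lift ord0 ord0) = inord 2 :> 'I_3.
  by apply/val_inj; rewrite /= inordK.
have F2 : lift (lift ord0 ord0) (lift ord0 ord0) = inord 2 :> 'I_3.
  by apply/val_inj; rewrite /= inordK.
(* Deleting row [i], and then row [j] of what remains, leaves the row of original index
   [bump i (bump j 0)]. *)
have rest (i : 'I_3) (j : 'I_2) (k : nat) : (k < 3)%N ->
    bump i (bump j 0) = k -> row' j (row' i M) = row (inord k) M.
  move=> k3 e; apply/rowP => c; rewrite !mxE.
  by congr (M _ _); apply/val_inj; rewrite /= inordK.
rewrite /ce_diff; under eq_bigr do rewrite big_mkcond.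
rewrite !big_ord_recl !big_ord0 /=.
rewrite (@rest ord0 ord0 2%N)// (@rest ord0 (lift ord0 ord0) 1%N)//.
rewrite (@rest (lift ord0 ord0) (lift ord0 ord0) 0%N)//.
rewrite F2 E2 E1 E0 /r.
by rewrite -!addnA ![(0 + _)%N]add0n; ring.
Qed.

Lemma ce_diff3E br (a : kform R n 3) (M : 'M[R]_(4, n))
    (r := fun i => row (inord i) M) :
  ce_diff br a M =
      - a (col_mx (br (r 0%N) (r 1%N)) (col_mx (r 2%N) (r 3%N)))
    + a (col_mx (br (r 0%N) (r 2%N)) (col_mx (r 1%N) (r 3%N)))
    - a (col_mx (br (r 0%N) (r 3%N)) (col_mx (r 1%N) (r 2%N)))
    - a (col_mx (br (r 1%N) (r 2%N)) (col_mx (r 0%N) (r 3%N)))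
    + a (col_mx (br (r 1%N) (r 3%N)) (col_mx (r 0%N) (r 2%N)))
    - a (col_mx (br (r 2%N) (r 3%N)) (col_mx (r 0%N) (r 1%N))).
Proof.
have E0 : ord0 = inord 0 :> 'I_4 by apply/val_inj; rewrite /= inordK.
have E1 : lift ord0 ord0 = inord 1 :> 'I_4 by apply/val_inj; rewrite /= inordK.
have E2 : lift ord0 (lift ord0 ord0) = inord 2 :> 'I_4.
  by apply/val_inj; rewrite /= inordK.
have E3 : lift ord0 (lift ord0 (lift ord0 ord0)) = inord 3 :> 'I_4.
  by apply/val_inj; rewrite /= inordK.
have F2 : lift (lift ord0 ord0) (lift ord0 ord0) = inord 2 :> 'I_4.
  by apply/val_inj; rewrite /= inordK.
have F3 : lift (lift ord0 ord0) (lift ord0 (lift ord0 ord0)) = inord 3 :> 'I_4.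
  by apply/val_inj; rewrite /= inordK.
have G3 : lift (lift ord0 (lift ord0 ord0)) (lift ord0 (lift ord0 ord0)) =
    inord 3 :> 'I_4.
  by apply/val_inj; rewrite /= inordK.
have rest (i : 'I_4) (j : 'I_3) (k l : nat) : (k < 4)%N -> (l < 4)%N ->
    bump i (bump j 0) = k -> bump i (bump j 1) = l ->
    row' j (row' i M) = col_mx (row (inord k) M) (row (inord l) M).
  move=> k4 l4 ek el; apply/matrixP => q c; rewrite !mxE.
  case: splitP => q'; rewrite ord1 mxE => eq;
    congr (M _ _); apply/val_inj; rewrite /= inordK //.
    by rewrite eq.
  by rewrite eq.
rewrite /ce_diff; under eq_bigr do rewrite big_mkcond.
rewrite !big_ord_recl !big_ord0 /=.
rewrite (@rest ord0 ord0 2%N 3%N)// (@rest ord0 (lift ord0 ord0) 1%N 3%N)//.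
rewrite (@rest ord0 (lift ord0 (lift ord0 ord0)) 1%N 2%N)//.
rewrite (@rest (lift ord0 ord0) (lift ord0 ord0) 0%N 3%N)//.
rewrite (@rest (lift ord0 ord0) (lift ord0 (lift ord0 ord0)) 0%N 2%N)//.
rewrite (@rest (lift ord0 (lift ord0 ord0)) (lift ord0 (lift ord0 ord0))
  0%N 1%N)//.
rewrite G3 F3 F2 E3 E2 E1 E0 /r.
by rewrite -!addnA ![(0 + _)%N]add0n; ring.
Qed.

End Forms.

(** * Entries of stacked row vectors *)

Section Rows.
Variables (R : realType) (n : nat).

(** A product of equations, rather than a conjunction, serves [rewrite] as a multi-rule. *)
Lemma col_mx2E (u v : 'rV[R]_n) c :
  ((col_mx u v : 'M[R]_(2, n)) (inord 0) c = u 0 c) *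
  ((col_mx u v : 'M[R]_(2, n)) (inord 1) c = v 0 c).
Proof.
split; rewrite mxE; case: splitP => j; rewrite !inordK // => e;
  by rewrite ?ord1 //; move: (ltn_ord j); rewrite -e.
Qed.

Lemma col_mx3E (u v w : 'rV[R]_n) c :
  ((col_mx u (col_mx v w) : 'M[R]_(3, n)) (inord 0) c = u 0 c) *
  ((col_mx u (col_mx v w) : 'M[R]_(3, n)) (inord 1) c = v 0 c) *
  ((col_mx u (col_mx v w) : 'M[R]_(3, n)) (inord 2) c = w 0 c).
Proof.
do 2?split; rewrite mxE; case: splitP => j; rewrite !inordK // => e;
  rewrite ?ord1 //; try by move: (ltn_ord j); rewrite -e.
  by rewrite -(col_mx2E v w c).1; congr (col_mx _ _ _ _);
    apply/val_inj; rewrite /= inordK //; lia.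
by rewrite -(col_mx2E v w c).2; congr (col_mx _ _ _ _);
    apply/val_inj; rewrite /= inordK //; lia.
Qed.

End Rows.

(** * Structure constants and gradings of the six algebras *)

Section Data.
Variables (R : realType) (m : R).

(* [coefs] lists g, d, al, be, ze, eta such that, up to the e^7 terms,
   de^2 = - m (g e^45 + d e^16), de^3 = m (al e^15 - be e^46),
   de^4 = m ze e^25 and de^6 = m eta e^12. *)
Definition coefs (a : label) : seq R :=
  match a with
  | alg_A => [:: 0; 0; 2 / 3; 0; 0; 0]
  | alg_B => [:: 0; 0; 1 / 2; 1 / 2; 0; 0]
  | alg_C => [:: 2 / 5; 0; 2 / 5; 2 / 5; 0; 0]
  | alg_D => [:: 1 / 2; 0; 0; 1 / 2; 0; 0]
  | alg_E => [:: 1 / 3; 1 / 3; 1 / 3; 1 / 3; 0; 0]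
  | alg_F => [:: 0; 0; 2 / 5; 0; 2 / 5; 2 / 5]
  end.

(* The coframe of h(T) is f^i = (1 - m T)^(a_i) e^i, where
   de^i = - m (1 - a_i) e^i7 + ... *)
Definition exponents (a : label) : seq R :=
  match a with
  | alg_A => [:: 1 / 3; 0; - 1 / 3; 0; 1 / 3; 0]
  | alg_B => [:: 1 / 4; 0; - 1 / 2; 1 / 4; 1 / 4; 1 / 4]
  | alg_C => [:: 1 / 5; - 1 / 5; - 2 / 5; 2 / 5; 2 / 5; 1 / 5]
  | alg_D => [:: 0; - 1 / 4; - 1 / 4; 1 / 2; 1 / 4; 1 / 4]
  | alg_E => [:: 1 / 3; - 1 / 3; - 1 / 3; 1 / 3; 1 / 3; 1 / 3]
  | alg_F => [:: 2 / 5; 2 / 5; - 1 / 5; - 1 / 5; 2 / 5; - 1 / 5]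
  end.

(** One parametric formula replaces six tables: later computations are made once, and only
    arithmetic relations among [coefs] and [exponents] are checked algebra by algebra. *)
Lemma s_bracketE a (X Y : 'rV[R]_7)
    (b := fun i j => X 0 (inord i.-1) * Y 0 (inord j.-1)
                   - X 0 (inord j.-1) * Y 0 (inord i.-1))
    (w := fun i => 1 - (exponents a)`_i.-1) (c := fun i => (coefs a)`_i) :
  s_bracket m a X Y = \row_(i < 7) (m * [::
    w 1%N * b 1%N 7%N;
    w 2%N * b 2%N 7%N + c 0%N * b 4%N 5%N + c 1%N * b 1%N 6%N;
    w 3%N * b 3%N 7%N - c 2%N * b 1%N 5%N + c 3%N * b 4%N 6%N;
    w 4%N * b 4%N 7%N - c 4%N * b 2%N 5%N;
    w 5%N * b 5%N 7%N;
    w 6%N * b 6%N 7%N - c 5%N * b 1%N 2%N; 0]`_i).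
Proof.
apply/rowP => i; rewrite !mxE (tnth_nth 0) /w /c.
have b_wedge p q : wedge1 1%:M [:: p; q]%N (col_mx X Y) = b p q.
  by rewrite wedge1_2E !mulmx1 !col_mx2E.
have Z k (f : kform R 7 2) M : (k *: f) M = k * f M by [].
case: a {w c} => /=; case: i => -[|[|[|[|[|[|[|//]]]]]]] //= _;
  rewrite ?fctE ?Z ?fctE ?Z ?fctE ?Z -?[_ *: _]/(_ * _) ?b_wedge; try by field.
all: by rewrite mulr0 -[RHS]oppr0.
Qed.

Lemma row_mx_inord (X : 'rV[R]_6) (z : 'rV[R]_1) :
  (forall k, (k < 6)%N ->
     (row_mx X z : 'rV[R]_7) 0 (inord k) = X 0 (inord k)) *
  ((row_mx X z : 'rV[R]_7) 0 (inord 6) = z 0 0).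
Proof.
split=> [k k6|]; rewrite mxE; case: splitP => j;
  rewrite inordK ?ord1//; try lia.
  by move=> kj; congr (X _ _); apply/val_inj; rewrite /= inordK.
by move=> e; move: (ltn_ord j); rewrite -e.
Qed.

Lemma n_bracketE a (X Y : 'rV[R]_6) (i : 'I_6)
    (b := fun i j => X 0 (inord i.-1) * Y 0 (inord j.-1)
                   - X 0 (inord j.-1) * Y 0 (inord i.-1))
    (c := fun i => (coefs a)`_i) :
  n_bracket m a X Y 0 i = m * [:: 0;
    c 0%N * b 4%N 5%N + c 1%N * b 1%N 6%N;
    - c 2%N * b 1%N 5%N + c 3%N * b 4%N 6%N;
    - c 4%N * b 2%N 5%N; 0; - c 5%N * b 1%N 2%N]`_i.
Proof.
rewrite /n_bracket s_bracketE 2!mxE.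
rewrite !(row_mx_inord _ _).2 !(row_mx_inord _ _).1 // !mxE /=.
by case: i => -[|[|[|[|[|[|//]]]]]] //= _; rewrite /b /c /=; ring.
Qed.

Lemma weightE a (i : 'I_6) : weight m a i = - (m * (1 - (exponents a)`_i)).
Proof.
have d7 (k j : nat) : (k < 7)%N -> (j < 7)%N ->
    (delta_mx 0 (inord k) : 'rV[R]_7) 0 (inord j) = (j == k)%:R.
  by move=> k7 j7; rewrite mxE /= -val_eqE /= !inordK.
have -> : weight m a i = s_bracket m a (delta_mx 0 (inord 6))
    (delta_mx 0 (inord i)) 0 (lshift 1 i).
  congr (s_bracket _ _ (delta_mx _ _) (delta_mx _ _) _ _);
    apply/val_inj; rewrite /= inordK //.
  by apply: ltn_trans (ltn_ord i) _.
rewrite s_bracketE mxE; case: i => -[|[|[|[|[|[|//]]]]]] //= ?;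
  by rewrite !d7 //=; ring.
Qed.

(** A term e^pq occurs in de^k only if 1 + a_k = a_p + a_q, that is w_k = w_p + w_q with w_i = m (1
    - a_i); hence ad(e_7) is a derivation of n. The factor [c] makes the relation vacuous for absent
    terms. *)
Lemma coefs_graded a (c := fun i => (coefs a)`_i)
    (x := fun i => (exponents a)`_i.-1) :
  [/\ c 0%N * (1 + x 2%N - (x 4%N + x 5%N)) = 0,
      c 1%N * (1 + x 2%N - (x 1%N + x 6%N)) = 0,
      - c 2%N * (1 + x 3%N - (x 1%N + x 5%N)) = 0,
      c 3%N * (1 + x 3%N - (x 4%N + x 6%N)) = 0 &
      - c 4%N * (1 + x 4%N - (x 2%N + x 5%N)) = 0 /\
      - c 5%N * (1 + x 6%N - (x 1%N + x 2%N)) = 0].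
Proof. by rewrite {}/c {}/x; case: a => /=; do !split; field. Qed.

(* The bracket is graded by the weights w_i = m (1 - a_i). *)
Lemma exp_ad_bracket a s (X Y : 'rV[R]_6) :
  n_bracket m a (exp_ad m a s X) (exp_ad m a s Y) =
  exp_ad m a s (n_bracket m a X Y).
Proof.
have ew k : (k < 6)%N -> forall Z, exp_ad m a s Z 0 (inord k) =
    expR (s * - (m * (1 - (exponents a)`_k))) * Z 0 (inord k).
  by move=> k6 Z; rewrite mxE weightE inordK.
apply/rowP => i; rewrite [RHS]mxE !n_bracketE !ew// weightE.
set E := fun r : R => expR (s * - (m * (1 - r))).
rewrite -![expR _]/(E _).
have EE (q r t : R) : 1 + t = q + r -> E q * E r = E t.
  by move=> h; rewrite /E -expRD; congr expR; rewrite -!mulrDr -opprD;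
     congr (_ * - _); rewrite -mulrDr; congr (_ * _); lra.
(* A bracket term either has coefficient 0 or satisfies the grading relation, in which case its two
   exponentials combine into one. *)
have key (c q r t x y z w : R) : c * (1 + t - (q + r)) = 0 ->
  c * (E q * x * (E r * y) - E r * z * (E q * w)) = E t * (c * (x * y - z * w)).
  move=> /eqP; rewrite mulf_eq0 => /orP[/eqP->|]; first by rewrite !mul0r mulr0.
  by rewrite subr_eq0 => /eqP h; rewrite -(EE _ _ _ h); ring.
have /= := coefs_graded a; case => g0 g1 g2 g3 [g4 g5].
case: i => -[|[|[|[|[|[|//]]]]]] //= ?; try by rewrite !mulr0.
all: rewrite [RHS]mulrCA; congr (m * _).

- by rewrite (key _ _ _ _ _ _ _ _ g0) (key _ _ _ _ _ _ _ _ g1) -mulrDr.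
- by rewrite (key _ _ _ _ _ _ _ _ g2) (key _ _ _ _ _ _ _ _ g3) -mulrDr.
- by rewrite (key _ _ _ _ _ _ _ _ g4).
- by rewrite (key _ _ _ _ _ _ _ _ g5).
Qed.

End Data.

(** * The SU(3) structure determined by a coframe *)

Section SU3.
Variables (R : realType) (f : 'M[R]_6).

Definition coframe_omega : kform R 6 2 :=
  wedge1 f [:: 1; 4] - wedge1 f [:: 2; 3] + wedge1 f [:: 5; 6].

(** Together with [coframe_psim], the real and imaginary parts of (f^1 + i f^4) /\ (f^2 - i f^3) /\
    (f^5 + i f^6), multiplied out. *)
Definition coframe_psip : kform R 6 3 :=
  wedge1 f [:: 1; 2; 5] - wedge1 f [:: 3; 4; 5]
  + wedge1 f [:: 1; 3; 6] + wedge1 f [:: 2; 4; 6].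

Definition coframe_psim : kform R 6 3 :=
  wedge1 f [:: 1; 2; 6] - wedge1 f [:: 1; 3; 5]
  - wedge1 f [:: 2; 4; 5] - wedge1 f [:: 3; 4; 6].

Definition coframe_metric (X Y : 'rV[R]_6) : R :=
  \sum_i (X *m f) 0 i * (Y *m f) 0 i.

Lemma su3_coframe : f \in unitmx ->
  su3_structure coframe_omega coframe_psip coframe_psim coframe_metric.
Proof.
move=> fu; exists f => //; split => // M.
pose v r i := (M *m f) (inord r) (inord i.-1).
transitivity (\det (\matrix_(r < 3, c < 3)
    nth 0 [:: Complex (v r 1%N) (v r 4%N); Complex (v r 2%N) (- v r 3%N);
              Complex (v r 5%N) (v r 6%N)] c)); last first.
  by congr (\det _); apply/matrixP => r c; rewrite !mxE /v inord_val.
rewrite (det3_nat (fun r c => nth 0 [:: Complex (v r 1%N) (v r 4%N);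
  Complex (v r 2%N) (- v r 3%N); Complex (v r 5%N) (v r 6%N)] c)) /=.
rewrite /coframe_psip /coframe_psim !fctE !wedge1_3E -!/(v _ _) /=.
by simpc; congr Complex; ring.
Qed.

End SU3.

(** * The rescaled coframe and the T-derivatives of its forms *)

Section Evolution.
Variables (R : realType) (m : R) (a : label).
Implicit Type T : R.

Definition coframe T : 'M[R]_6 :=
  diag_mx (\row_(i < 6) (1 - m * T) `^ (exponents R a)`_i).

Lemma coframe0 : coframe 0 = 1%:M.
Proof.
rewrite /coframe mulr0 subr0.
rewrite (_ : \row__ _ = const_mx 1) ?diag_const_mx//.
by apply/rowP => i; rewrite !mxE powR1.
Qed.

Lemma unitmx_coframe T : dom m T -> coframe T \in unitmx.
Proof.
move=> uT; rewrite unitmxE det_diag unitfE; apply/prodf_neq0 => i _.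
by rewrite mxE gt_eqF// powR_gt0.
Qed.

Definition weights_sum (s : seq nat) : R :=
  \sum_(i <- s) (exponents R a)`_i.-1.

(** Positivity of u lets the exponents add up; the bound on the indices keeps [inord] away from its
    default value. *)
Lemma wedge1_coframe T s M : dom m T -> all (leq^~ 6) s ->
  wedge1 (coframe T) s M =
  (1 - m * T) `^ weights_sum s * wedge1 1%:M s M.
Proof.
move=> uT s6; rewrite wedge1_diag; congr (_ * _); rewrite /weights_sum.
move=> {M}; elim: s s6 => [|i s IH] /=; first by rewrite !big_nil powRr0.
move=> /andP[i6 /IH IHs]; rewrite !big_cons IHs powRD.
  by rewrite mxE inordK //; case: i i6.
by rewrite (gt_eqF uT) implybT.
Qed.

Lemma is_derive_wedge1_coframe T s M : dom m T -> all (leq^~ 6) s ->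
  is_derive (T : R^o) 1 (fun T => wedge1 (coframe T) s M : R^o)
   (- (m * (weights_sum s * (1 - m * T) `^ (weights_sum s - 1)))
      * wedge1 1%:M s M).
Proof.
move=> uT s6.
have dp := is_derive_pow (weights_sum s) uT.
have dw : is_derive (T : R^o) 1
  (wedge1 1%:M s M *: (fun T => (1 - m * T) `^ weights_sum s) : R^o -> R^o)
   (- (m * (weights_sum s * (1 - m * T) `^ (weights_sum s - 1)))
      * wedge1 1%:M s M).
  by apply: is_derive_eq; rewrite [_ *: _]mulrC; ring.
(* The power formula holds where u is positive, hence near [T], and derivatives depend only on the
   germ. *)
apply: near_eq_is_derive dw.
apply: filterS (open_nbhs_nbhs (conj (@open_dom _ _) uT)) => T' uT'.
by rewrite wedge1_coframe// mulrC.
Qed.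

Definition omega T := coframe_omega (coframe T).
Definition psip T := coframe_psip (coframe T).
Definition psim T := coframe_psim (coframe T).

Local Notation W s M := (fun T => wedge1 (coframe T) s M : R^o).

Lemma derive_psip T M : dom m T ->
  derive1 (fun T : R^o => psip T M) T =
  let D s := - (m * (weights_sum s * (1 - m * T) `^ (weights_sum s - 1))) in
  D [:: 1; 2; 5]%N * wedge1 1%:M [:: 1; 2; 5] M
  - D [:: 3; 4; 5]%N * wedge1 1%:M [:: 3; 4; 5] M
  + D [:: 1; 3; 6]%N * wedge1 1%:M [:: 1; 3; 6] M
  + D [:: 2; 4; 6]%N * wedge1 1%:M [:: 2; 4; 6] M.
Proof.
move=> uT; have -> : (fun T : R^o => psip T M) =
  W [:: 1; 2; 5] M - W [:: 3; 4; 5] M + W [:: 1; 3; 6] M + W [:: 2; 4; 6] M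
  by [].
have d1 := @is_derive_wedge1_coframe T [:: 1; 2; 5]%N M uT isT.
have d2 := @is_derive_wedge1_coframe T [:: 3; 4; 5]%N M uT isT.
have d3 := @is_derive_wedge1_coframe T [:: 1; 3; 6]%N M uT isT.
have d4 := @is_derive_wedge1_coframe T [:: 2; 4; 6]%N M uT isT.
rewrite derive1E; apply: derive_val.
Qed.

Lemma derive_omega T M : dom m T ->
  derive1 (fun T : R^o => omega T M) T =
  let D s := - (m * (weights_sum s * (1 - m * T) `^ (weights_sum s - 1))) in
  D [:: 1; 4]%N * wedge1 1%:M [:: 1; 4] M
  - D [:: 2; 3]%N * wedge1 1%:M [:: 2; 3] M
  + D [:: 5; 6]%N * wedge1 1%:M [:: 5; 6] M.
Proof.
move=> uT; have -> : (fun T : R^o => omega T M) =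
  W [:: 1; 4] M - W [:: 2; 3] M + W [:: 5; 6] M by [].
have d1 := @is_derive_wedge1_coframe T [:: 1; 4]%N M uT isT.
have d2 := @is_derive_wedge1_coframe T [:: 2; 3]%N M uT isT.
have d3 := @is_derive_wedge1_coframe T [:: 5; 6]%N M uT isT.
rewrite derive1E; apply: derive_val.
Qed.

Lemma smooth_wedge1_coframe s M (U := dom m : set R^o) : all (leq^~ 6) s ->
  smooth U (fun T : R^o => wedge1 (coframe T) s M : R^o).
Proof.
move=> s6 k; have oU : open U by exact: open_dom.
(* The parameter is one-dimensional here, so the linear functional composed with the profile is the
   identity. *)
have idc : continuous (idfun : {linear R^o -> R^o}) by move=> x; exact.
have dD := @is_derive_pow_derivs _ m (weights_sum s).
have := Ck_scalar_comp k (wedge1 1%:M s M : R^o) oU idc dD.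
move=> /(_ (fun x => id)); apply: Ck_eq => // T uT.
rewrite wedge1_coframe// /pow_derivs big_ord0 mul1r subr0.
by [].
Qed.

Lemma smooth_omega M :
  smooth (dom m : set R^o) (fun T : R^o => omega T M : R^o).
Proof.
move=> k; have oU : open (dom m : set R^o) by exact: open_dom.
change (Ck k (dom m : set R^o)
  (W [:: 1; 4] M - W [:: 2; 3] M + W [:: 5; 6] M : R^o -> R^o)).
apply: Ck_add => //; last exact: smooth_wedge1_coframe.
apply: Ck_add => //; first exact: smooth_wedge1_coframe.
by apply: Ck_opp => //; exact: smooth_wedge1_coframe.
Qed.

Lemma smooth_psip M :
  smooth (dom m : set R^o) (fun T : R^o => psip T M : R^o).
Proof.
move=> k; have oU : open (dom m : set R^o) by exact: open_dom.
change (Ck k (dom m : set R^o) (W [:: 1; 2; 5] M - W [:: 3; 4; 5] M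
  + W [:: 1; 3; 6] M + W [:: 2; 4; 6] M : R^o -> R^o)).
apply: Ck_add => //; last exact: smooth_wedge1_coframe.
apply: Ck_add => //; last exact: smooth_wedge1_coframe.
apply: Ck_add => //; first exact: smooth_wedge1_coframe.
by apply: Ck_opp => //; exact: smooth_wedge1_coframe.
Qed.

End Evolution.

(** * The two evolution equations *)

Section Flow.
Variables (R : realType) (m : R) (a : label).
Implicit Type T : R.

Let c i := (coefs R a)`_i.
Let ws s := weights_sum R a s.

Lemma mulr_powR_eq (u b q r : R) : b * (q - r) = 0 -> b * u `^ q = b * u `^ r.
Proof.
move/eqP; rewrite mulf_eq0 subr_eq0 => /orP[]/eqP->//.
by rewrite !mul0r.
Qed.

(** Every term with nonzero coefficient carries the power p - 1. An identity between functions of u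
    thus reduces to arithmetic: one equation for the coefficients and one condition per exponent. *)
Lemma mulr_powR_sum4 (u p c1 c2 c3 c4 q1 q2 q3 q4 : R) :
  p = c1 + c2 + c3 + c4 ->
  c1 * (q1 - (p - 1)) = 0 -> c2 * (q2 - (p - 1)) = 0 ->
  c3 * (q3 - (p - 1)) = 0 -> c4 * (q4 - (p - 1)) = 0 ->
  p * u `^ (p - 1) =
  c1 * u `^ q1 + c2 * u `^ q2 + c3 * u `^ q3 + c4 * u `^ q4.
Proof.
move=> pc /(mulr_powR_eq u)-> /(mulr_powR_eq u)-> /(mulr_powR_eq u)->.
by move=> /(mulr_powR_eq u)->; rewrite -!mulrDl -pc.
Qed.

Lemma mulr_powR_sum3 (u p c1 c2 c3 q1 q2 q3 : R) : p = c1 + c2 + c3 ->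
  c1 * (q1 - (p - 1)) = 0 -> c2 * (q2 - (p - 1)) = 0 ->
  c3 * (q3 - (p - 1)) = 0 ->
  p * u `^ (p - 1) = c1 * u `^ q1 + c2 * u `^ q2 + c3 * u `^ q3.
Proof.
move=> pc h1 h2 h3.
(* The padding term has coefficient 0, so its exponent [q3] is an arbitrary choice. *)
rewrite (@mulr_powR_sum4 u p c1 c2 c3 0 q1 q2 q3 q3) ?addr0//.
  by rewrite mul0r addr0.
by rewrite mul0r.
Qed.

Lemma mulr_powR_sum1 (u p c1 q1 : R) : p = c1 -> c1 * (q1 - (p - 1)) = 0 ->
  p * u `^ (p - 1) = c1 * u `^ q1.
Proof. by move=> pc /(mulr_powR_eq u)->; rewrite -pc. Qed.

(** The coefficients of e^125, e^345, e^136 and e^246 in the first evolution equation, with the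
    common factor [m] and the signs removed. *)
Lemma flow_exponents1 (u : R) (P := fun s : seq nat => u `^ ws s)
    (P' := fun s : seq nat => ws s * u `^ (ws s - 1)) :
  [/\ P' [:: 1; 2; 5]%N = c 4%N * P [:: 1; 4]%N + c 2%N * P [:: 2; 3]%N
                          + c 5%N * P [:: 5; 6]%N,
      P' [:: 3; 4; 5]%N = c 0%N * P [:: 2; 3]%N,
      P' [:: 1; 3; 6]%N = c 1%N * P [:: 2; 3]%N &
      P' [:: 2; 4; 6]%N = c 3%N * P [:: 2; 3]%N].
Proof.
rewrite /P /P' /ws /c /weights_sum !big_cons !big_nil.
by split; [apply: mulr_powR_sum3|apply: mulr_powR_sum1..]; case: a => /=; field.
Qed.

(** The coefficients of e^1456, e^2356 and e^1234 in the second evolution equation. Each product of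
    two coefficients of [omega] is met twice in the wedge with the derivative, once per
    differentiated factor, whence the Leibniz sums. *)
Lemma flow_exponents2 (u : R) (P := fun s : seq nat => u `^ ws s)
    (P' := fun s : seq nat => ws s * u `^ (ws s - 1)) : 0 < u ->
  [/\ P' [:: 1; 4]%N * P [:: 5; 6]%N + P [:: 1; 4]%N * P' [:: 5; 6]%N =
        c 0%N * P [:: 1; 2; 6]%N + c 3%N * P [:: 1; 3; 5]%N
        + c 1%N * P [:: 2; 4; 5]%N + c 2%N * P [:: 3; 4; 6]%N,
      P' [:: 2; 3]%N * P [:: 5; 6]%N + P [:: 2; 3]%N * P' [:: 5; 6]%N =
        c 4%N * P [:: 3; 4; 6]%N &
      P' [:: 1; 4]%N * P [:: 2; 3]%N + P [:: 1; 4]%N * P' [:: 2; 3]%N =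
        c 5%N * P [:: 3; 4; 6]%N].
Proof.
move=> u0.
(* Since u^x u^y = u^(x+y), a Leibniz sum is a single power, in the shape that the matching lemmas
   expect. *)
have HD s s' : P' s * P s' + P s * P' s' =
    (ws s + ws s') * u `^ (ws s + ws s' - 1).
  have HP x y : u `^ (x - 1) * u `^ y = u `^ (x + y - 1).
    by rewrite -powRD ?(gt_eqF u0) ?implybT//; congr (_ `^ _); ring.
  rewrite /P /P' -mulrA HP mulrCA [u `^ _ * _]mulrC HP [ws s' + _]addrC.
  by rewrite -mulrDl.
rewrite !HD /P /ws /c /weights_sum !big_cons !big_nil.
by split; [apply: mulr_powR_sum4|apply: mulr_powR_sum1..]; case: a => /=; field.
Qed.

Lemma wedge1_rows2 i j (u v : 'rV[R]_6)
    (x := fun w : 'rV[R]_6 => fun i => w 0 (inord i.-1)) :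
  wedge1 (1%:M : 'M[R]_6) [:: i; j] (col_mx u v) =
  x u i * x v j - x u j * x v i.
Proof. by rewrite wedge1_2E !mulmx1 !col_mx2E. Qed.

Lemma wedge1_rows3 i j k (u v w : 'rV[R]_6)
    (x := fun w : 'rV[R]_6 => fun i => w 0 (inord i.-1)) :
  wedge1 (1%:M : 'M[R]_6) [:: i; j; k] (col_mx u (col_mx v w)) =
  x u i * (x v j * x w k - x v k * x w j) -
  x u j * (x v i * x w k - x v k * x w i) +
  x u k * (x v i * x w j - x v j * x w i).
Proof. by rewrite wedge1_3E !mulmx1 !col_mx3E. Qed.

(** Coordinates are numbered from 0, but the indices in [b] start at 1, as in the structure
    equations. Only scalars occur, which suits [ring]. *)
Definition bracket_coord (x y : nat -> R) (k : nat)
    (b := fun i j : nat => x i.-1 * y j.-1 - x j.-1 * y i.-1) : R :=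
  m * [:: 0; c 0%N * b 4%N 5%N + c 1%N * b 1%N 6%N;
    - c 2%N * b 1%N 5%N + c 3%N * b 4%N 6%N;
    - c 4%N * b 2%N 5%N; 0; - c 5%N * b 1%N 2%N]`_k.

Lemma n_bracket_row n (M : 'M[R]_(n.+1, 6)) i j k : (k < 6)%N ->
  n_bracket m a (row (inord i) M) (row (inord j) M) 0 (inord k) =
  bracket_coord (fun l => M (inord i) (inord l))
    (fun l => M (inord j) (inord l)) k.
Proof. by move=> k6; rewrite n_bracketE inordK// !mxE. Qed.

Lemma ce_diff_wedge1_2 i j (M : 'M[R]_(3, 6)) : (i.-1 < 6)%N -> (j.-1 < 6)%N ->
  ce_diff (n_bracket m a) (wedge1 1%:M [:: i; j]) M =
  let x r k := M (inord r) (inord k) in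
  let f r s t := bracket_coord (x r) (x s) i.-1 * x t j.-1
                 - bracket_coord (x r) (x s) j.-1 * x t i.-1 in
  - f 0%N 1%N 2%N + f 0%N 2%N 1%N - f 1%N 2%N 0%N.
Proof.
move=> i6 j6; have rowE r l : row r M 0 l = M r l by rewrite mxE.
rewrite ce_diff2E !wedge1_rows2 !n_bracket_row//.
by rewrite /= !rowE.
Qed.

Lemma ce_diff_wedge1_3 i j k (M : 'M[R]_(4, 6)) :
    (i.-1 < 6)%N -> (j.-1 < 6)%N -> (k.-1 < 6)%N ->
  ce_diff (n_bracket m a) (wedge1 1%:M [:: i; j; k]) M =
  let x r l := M (inord r) (inord l) in
  let f r s t u :=
    bracket_coord (x r) (x s) i.-1 *
        (x t j.-1 * x u k.-1 - x t k.-1 * x u j.-1)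
    - bracket_coord (x r) (x s) j.-1 *
        (x t i.-1 * x u k.-1 - x t k.-1 * x u i.-1)
    + bracket_coord (x r) (x s) k.-1 *
        (x t i.-1 * x u j.-1 - x t j.-1 * x u i.-1)
  in - f 0%N 1%N 2%N 3%N + f 0%N 2%N 1%N 3%N - f 0%N 3%N 1%N 2%N
     - f 1%N 2%N 0%N 3%N + f 1%N 3%N 0%N 2%N - f 2%N 3%N 0%N 1%N.
Proof.
move=> i6 j6 k6; have rowE r l : row r M 0 l = M r l by rewrite mxE.
rewrite ce_diff3E !wedge1_rows3 !n_bracket_row//.
by rewrite /= !rowE.
Qed.

Lemma ce_diffD n k br (f g : kform R n k.+1) M :
  ce_diff br (f + g) M = ce_diff br f M + ce_diff br g M.
Proof.
rewrite /ce_diff -big_split; apply: eq_bigr => i _ /=.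
by rewrite -big_split; apply: eq_bigr => j _ /=; rewrite fctE mulrDr.
Qed.

Lemma ce_diffZ n k br x (f : kform R n k.+1) M :
  ce_diff br (x *: f) M = x * ce_diff br f M.
Proof.
rewrite /ce_diff mulr_sumr; apply: eq_bigr => i _ /=.
by rewrite mulr_sumr; apply: eq_bigr => j _ /=; rewrite mulrCA.
Qed.

Local Notation e := (wedge1 (1%:M : 'M[R]_6)).

(** On n only e^2, e^3, e^4 and e^6 can fail to be closed, so the Leibniz rule leaves few terms; in
    coordinates each equation is a polynomial identity. *)
Lemma ce_diff_basis2 (M : 'M[R]_(3, 6)) (d := @ce_diff R 6 1 (n_bracket m a)) :
  [/\ d (e [:: 1; 4]) M = - (m * c 4%N) * e [:: 1; 2; 5] M,
      d (e [:: 2; 3]) M = m * (- c 0%N * e [:: 3; 4; 5] M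
        + c 1%N * e [:: 1; 3; 6] M + c 2%N * e [:: 1; 2; 5] M
        + c 3%N * e [:: 2; 4; 6] M) &
      d (e [:: 5; 6]) M = - (m * c 5%N) * e [:: 1; 2; 5] M].
Proof.
rewrite /d !ce_diff_wedge1_2 // !wedge1_3E !mulmx1 /bracket_coord /=.
by split; ring.
Qed.

Lemma ce_diff_basis3 (M : 'M[R]_(4, 6)) (d := @ce_diff R 6 2 (n_bracket m a)) :
  [/\ d (e [:: 1; 2; 6]) M = m * c 0%N * e [:: 1; 4; 5; 6] M,
      d (e [:: 1; 3; 5]) M = - (m * c 3%N) * e [:: 1; 4; 5; 6] M,
      d (e [:: 2; 4; 5]) M = - (m * c 1%N) * e [:: 1; 4; 5; 6] M &
      d (e [:: 3; 4; 6]) M = m * (- c 2%N * e [:: 1; 4; 5; 6] M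
        + c 4%N * e [:: 2; 3; 5; 6] M + c 5%N * e [:: 1; 2; 3; 4] M)].
Proof.
rewrite /d !ce_diff_wedge1_3 // !wedge1_4E !mulmx1 /bracket_coord /=.
by split; ring.
Qed.

Let P T s := (1 - m * T) `^ ws s.
Let P' T s := ws s * (1 - m * T) `^ (ws s - 1).

Lemma omegaE T : dom m T -> omega m a T =
  P T [:: 1; 4]%N *: e [:: 1; 4] + - P T [:: 2; 3]%N *: e [:: 2; 3] +
  P T [:: 5; 6]%N *: e [:: 5; 6].
Proof.
move=> uT; apply/funext => M.
rewrite /omega /coframe_omega !fctE !wedge1_coframe//.
by rewrite /GRing.scale /= mulNr.
Qed.

Lemma psimE T : dom m T -> psim m a T =
  P T [:: 1; 2; 6]%N *: e [:: 1; 2; 6] +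
  - P T [:: 1; 3; 5]%N *: e [:: 1; 3; 5] +
  - P T [:: 2; 4; 5]%N *: e [:: 2; 4; 5] +
  - P T [:: 3; 4; 6]%N *: e [:: 3; 4; 6].
Proof.
move=> uT; apply/funext => M.
rewrite /psim /coframe_psim !fctE !wedge1_coframe//.
by rewrite /GRing.scale /= !mulNr.
Qed.

Lemma flow_psip T M : dom m T ->
  ce_diff (n_bracket m a) (omega m a T) M =
  derive1 (fun T : R^o => psip m a T M) T.
Proof.
move=> uT; rewrite derive_psip// omegaE// !ce_diffD !ce_diffZ.
have [-> -> ->] := ce_diff_basis2 M.
have [/= -> -> -> ->] := flow_exponents1 (1 - m * T).
by rewrite /P /ws; ring.
Qed.

Lemma flow_omega T M : dom m T ->
  ce_diff (n_bracket m a) (psim m a T) M =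
  - wedge (omega m a T)
      (fun M' => derive1 (fun T' : R^o => omega m a T' M') T) M.
Proof.
move=> uT.
have -> : (fun M' => derive1 (fun T' : R^o => omega m a T' M') T) =
  - (m * P' T [:: 1; 4]%N) *: e [:: 1; 4] +
  (m * P' T [:: 2; 3]%N) *: e [:: 2; 3] +
  - (m * P' T [:: 5; 6]%N) *: e [:: 5; 6].
  apply/funext => M'; rewrite derive_omega//= !fctE /GRing.scale /=.
  by congr (_ + _ + _); rewrite mulNr opprK.
rewrite psimE// omegaE// !ce_diffD !ce_diffZ.
have [-> -> -> ->] := ce_diff_basis3 M.
rewrite !wedgeDl !wedgeDr !wedgeZl !wedgeZr !wedge_wedge1.
have [/= e1 e2 e3] := flow_exponents2 uT.
(* The left-hand side is collected by basis 4-forms, exposing the sums that [e1], [e2] and [e3]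
   convert. *)
transitivity (m * (
  (c 0%N * P T [:: 1; 2; 6]%N + c 3%N * P T [:: 1; 3; 5]%N
        + c 1%N * P T [:: 2; 4; 5]%N + c 2%N * P T [:: 3; 4; 6]%N)
    * e [:: 1; 4; 5; 6] M -
  (c 4%N * P T [:: 3; 4; 6]%N) * e [:: 2; 3; 5; 6] M -
  (c 5%N * P T [:: 3; 4; 6]%N) * e [:: 1; 2; 3; 4] M)); first by ring.
rewrite -e1 -e2 -e3 /P /P' /ws.
(* In coordinates the products with a repeated index vanish, and the two orders of each remaining
   product agree. *)
rewrite !wedge1_4E !mulmx1.
by ring.
Qed.

End Flow.

(** * Maurer-Cartan forms of N and S, and primitives of e^7 *)

Section MaurerCartan.
Variables (R : realType) (m : R) (a : label).

Lemma npart_spair (x : 'rV[R]_6) s : npart (spair x s) = x.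
Proof. exact: row_mxKl. Qed.

Lemma spair_last (x : 'rV[R]_6) s : spair x s 0 ord_max = s.
Proof.
have -> : ord_max = inord 6 :> 'I_7 by apply/val_inj; rewrite /= inordK.
by rewrite (row_mx_inord _ _).2 mxE eqxx.
Qed.

Lemma tpart_spair (x : 'rV[R]_6) s : tpart (spair x s) = s.
Proof. exact: spair_last. Qed.

Lemma spair_lshift (x : 'rV[R]_6) s (i : 'I_6) :
  spair x s 0 (lshift 1 i) = x 0 i.
Proof. exact: row_mxEl. Qed.

Lemma spairK (p : 'rV[R]_7) : spair (npart p) (tpart p) = p.
Proof.
rewrite -[RHS](@hsubmxK R 1 6 1); rewrite /spair; congr (@row_mx R 1 6 1 _ _).
rewrite [RHS]mx11_scalar mxE; congr (p _ _)%:M.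
exact/val_inj.
Qed.

Lemma spairD (x y : 'rV[R]_6) s r :
  spair x s + spair y r = spair (x + y) (s + r).
Proof. by rewrite /spair [LHS](@add_row_mx _ 1 6 1) -raddfD. Qed.

Lemma spairZ k (x : 'rV[R]_6) s : k *: spair x s = spair (k *: x) (k * s).
Proof. by rewrite /spair [LHS](@scale_row_mx _ 1 6 1) scale_scalar_mx. Qed.

Lemma npart_is_linear : linear (@npart R).
Proof. by move=> k x y; rewrite /npart linearP. Qed.

Lemma tpart_is_linear : linear (@tpart R : _ -> R^o).
Proof. by move=> k x y; rewrite /tpart !mxE. Qed.

Lemma exp_ad_is_linear s : linear (exp_ad m a s).
Proof. by move=> k x y; apply/rowP => i; rewrite !mxE; ring. Qed.

Lemma n_bracket_is_linear x : linear (n_bracket m a x).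
Proof.
move=> k y z.
have rowE u v i : (k *: u + v : 'rV[R]_6) 0 i = k * u 0 i + v 0 i.
  by rewrite !mxE.
apply/rowP => i; rewrite rowE !n_bracketE !rowE.
by case: i => -[|[|[|[|[|[|//]]]]]] //= ?; ring.
Qed.

Lemma n_bracketNl x y : n_bracket m a (- x) y = - n_bracket m a x y.
Proof.
apply/rowP => i; rewrite [RHS]mxE !n_bracketE !mxE.
by case: i => -[|[|[|[|[|[|//]]]]]] //= ?; ring.
Qed.

Lemma exp_adD s r x : exp_ad m a s (exp_ad m a r x) = exp_ad m a (s + r) x.
Proof.
apply/rowP => i; rewrite !mxE mulrA -expRD.
by rewrite -mulrDl.
Qed.

Lemma exp_ad0 x : exp_ad m a 0 x = x.
Proof. by apply/rowP => i; rewrite !mxE mul0r expR0 mul1r. Qed.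

HB.instance Definition _ :=
  GRing.isLinear.Build _ _ _ _ (@npart R) npart_is_linear.
HB.instance Definition _ :=
  GRing.isLinear.Build R 'rV[R]_7 R^o _ (@tpart R) tpart_is_linear.
HB.instance Definition _ s :=
  GRing.isLinear.Build _ _ _ _ (exp_ad m a s) (exp_ad_is_linear s).
HB.instance Definition _ x :=
  GRing.isLinear.Build _ _ _ _ (n_bracket m a x) (n_bracket_is_linear x).

(** The series (1 - exp(- ad x)) / ad x applied to [v], cut after its linear term because n is
    2-step nilpotent. *)
Definition mc_N x (v : 'rV[R]_6) : 'rV[R]_6 := v - 2^-1 *: n_bracket m a x v.

Lemma mc_N_is_linear x : linear (mc_N x).
Proof.
move=> k u v; rewrite /mc_N linearP /=.
by rewrite scalerDr scalerBr scalerA mulrC -scalerA addrACA -opprD.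
Qed.

HB.instance Definition _ x :=
  GRing.isLinear.Build _ _ _ _ (mc_N x) (mc_N_is_linear x).

Lemma theta_NE x v : theta_N m a x v = mc_N x v.
Proof.
have [_ h] : is_diff x (n_mul m a (n_inv x)) (mc_N x).
  apply: (affine_diff (b := - x)); first exact: linear_rV_continuous.
  move=> y; rewrite /n_mul /n_inv n_bracketNl scalerN /mc_N /=.
  by rewrite [RHS]addrC addrA.
by rewrite /theta_N /maurer_cartan h.
Qed.

Definition mc_S (p v : 'rV[R]_7) : 'rV[R]_7 :=
  spair (exp_ad m a (- tpart p) (mc_N (npart p) (npart v))) (tpart v).

Lemma mc_S_is_linear p : linear (mc_S p).
Proof.
by move=> k u v; rewrite /mc_S !linearP /= spairZ spairD.
Qed.

HB.instance Definition _ p :=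
  GRing.isLinear.Build _ _ _ _ (mc_S p) (mc_S_is_linear p).

(** [exp_ad] preserves the bracket, so it can be pulled out of the product on [N]; left translation
    by the inverse of [p] is then affine with linear part [mc_S p]. *)
Lemma theta_SE p v : theta_S m a p v = mc_S p v.
Proof.
have [_ h] : is_diff p (s_mul m a (s_inv m a p)) (mc_S p).
  apply: (affine_diff (b := s_inv m a p)); first exact: linear_rV_continuous.
  move=> q; rewrite /s_mul /s_inv npart_spair tpart_spair spairD.
  congr spair; last by rewrite addrC.
  rewrite /n_mul exp_ad_bracket /n_inv n_bracketNl !linearN /=.
  by rewrite /mc_N linearB /= [exp_ad _ _ _ (_ *: _)]linearZ /= -addrA addrC.
by rewrite /theta_S /maurer_cartan h.
Qed.

Lemma mc_N_exp_ad s x v :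
  mc_N (exp_ad m a s x) (exp_ad m a s v) = exp_ad m a s (mc_N x v).
Proof.
by rewrite /mc_N exp_ad_bracket linearB /= [exp_ad _ _ _ (_ *: _)]linearZ.
Qed.

(** The last component of the Maurer-Cartan form is the last coordinate of the vector, so [t] minus
    [tpart] has zero derivative along every line through the origin. *)
Lemma primitive_e7E (t : 'rV[R]_7 -> R^o) : primitive_e7 m a t ->
  forall p, t p = t 0 + tpart p.
Proof.
move=> ht p.
pose F (r : R) := t (r *: p) - r * tpart p.
suff: F 1 = F 0.
  by rewrite /F scale1r scale0r mul1r mul0r subr0 => <-; rewrite subrK.
apply: is_derive_0_is_cst => r.
have [dt et] := ht (r *: p).
have ds := is_diff_scalel r p.
have dtp : is_diff (r : R^o) (t \o ( *:%R ^~ p))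
    ('d t (r *: p) \o ( *:%R ^~ p)).
  by apply: is_diff_comp; exact: differentiableP.
have dl : is_diff (r : R^o) ( *:%R ^~ (tpart p : R^o))
    ( *:%R ^~ (tpart p : R^o)).
  exact: is_diff_scalel.
have [dF eF] : is_diff (r : R^o) (F : R^o -> R^o) (cst 0).
  apply: is_diff_eq (is_diffB dtp dl) _.
  apply/funext => h; rewrite !fctE /= et theta_SE spair_last.
  by rewrite /tpart mxE subrr.
apply: DeriveDef; first exact/derivable1_diffP.
by rewrite deriveE// eF.
Qed.

End MaurerCartan.

(** * The isometry between N x I and S *)

Section Isometry.
Variables (R : realType) (m : R) (a : label) (c : R).
Hypothesis m0 : m != 0.

Local Notation NI := ('rV[R]_6 * R^o)%type.
Local Notation expad := (exp_ad m a).

(** The last coordinate is set so that [c + tpart] equals - ln(u) / m, that is u = exp(- m t). The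
    two occurrences of [- c] amount to left translation by exp(- c e_7). *)
Definition to_S (p : NI) : 'rV[R]_7 :=
  spair (expad (- c) p.1) (- (ln (1 - m * p.2) / m) - c).

Definition of_S (q : 'rV[R]_7) : NI :=
  (expad c (npart q), (1 - expR (- m * (tpart q + c))) / m).

Definition to_S_lin (p : NI) : 'rV[R]_7 := spair (expad (- c) p.1) 0.
Definition of_S_lin (q : 'rV[R]_7) : NI := (expad c (npart q), 0).

Lemma to_S_lin_is_linear : linear to_S_lin.
Proof.
by move=> k p q; rewrite /to_S_lin /= linearP spairZ spairD mulr0 addr0.
Qed.

Lemma of_S_lin_is_linear : linear of_S_lin.
Proof.
move=> k p q; rewrite /of_S_lin !linearP /=; congr pair.
by rewrite -[RHS]/(k * 0 + 0) mulr0 addr0.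
Qed.

HB.instance Definition _ :=
  GRing.isLinear.Build _ _ _ _ to_S_lin to_S_lin_is_linear.
HB.instance Definition _ :=
  GRing.isLinear.Build _ _ _ _ of_S_lin of_S_lin_is_linear.

Lemma time_is_linear : linear (fun p : NI => p.2 : R^o).
Proof. by []. Qed.

Definition time : NI -> R^o := fun p => p.2.

HB.instance Definition _ :=
  GRing.isLinear.Build R NI R^o _ time time_is_linear.

Lemma continuous_time : continuous time.
Proof. by move=> p; exact: cvg_snd. Qed.

Lemma continuous_to_S_lin : continuous to_S_lin.
Proof.
(* The source is a product and not a row space, so continuity is obtained through the first
   projection. *)
move=> p; pose L (x : 'rV[R]_6) : 'rV[R]_7 := spair (expad (- c) x) 0.
have lL : linear L.
  by move=> k x y; rewrite /L linearP spairZ spairD mulr0 addr0.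
pose LL : {linear 'rV[R]_6 -> 'rV[R]_7} :=
  HB.pack L (GRing.isLinear.Build _ _ _ _ L lL).
apply: (@continuous_comp _ _ _ fst LL); first exact: cvg_fst.
exact: linear_rV_continuous.
Qed.

Lemma continuous_of_S_lin : continuous of_S_lin.
Proof. exact: linear_rV_continuous. Qed.

Definition NI_dom : set NI := [set p | dom m p.2].

Lemma open_NI_dom : open NI_dom.
Proof.
apply: (@open_comp _ _ time); last exact: open_dom.
by move=> p _; exact: continuous_time.
Qed.

Let e7 : 'rV[R]_7 := spair 0 1.
Let eT : NI := (0, 1).

(** Linear part, one-variable profile times a fixed vector, and constant: the decomposition to which
    [Ck_scalar_comp] and [is_diff_scalar_comp] apply. *)
Lemma to_SE p : to_S p =
  to_S_lin p + log_derivs m 0%N (time p) *: (- m^-1 *: e7) + - c *: e7.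
Proof.
rewrite /to_S /to_S_lin /e7 !spairZ !spairD !scaler0 !addr0.
by congr spair; rewrite /= /time; ring.
Qed.

Lemma of_SE q : of_S q =
  of_S_lin q
  + exp_derivs m 0%N (tpart q : R^o) *: (- (expR (- m * c) / m) *: eT)
  + m^-1 *: eT.
Proof.
rewrite /of_S /of_S_lin /eT /exp_derivs expr0 mul1r; congr pair => /=.
  by rewrite !scaler0 !addr0.
rewrite mulrDr expRD /GRing.scale /=; ring.
Qed.

Lemma smooth_to_S : smooth NI_dom to_S.
Proof.
move=> k; have oU := open_NI_dom.
have cl := continuous_time.
apply: (@Ck_eq _ _ _ k _ ((to_S_lin : NI -> 'rV[R]_7) +
  (fun p => log_derivs m 0%N (time p) *: (- m^-1 *: e7))
  + cst (- c *: e7))) => //.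
  by move=> p _; rewrite to_SE.
apply: Ck_add => //; last exact: Ck_cst.
apply: Ck_add => //; first exact: linear_Ck continuous_to_S_lin.
exact: (Ck_scalar_comp k _ oU cl (@is_derive_log_derivs _ m)).
Qed.

Lemma smooth_of_S : smooth [set: 'rV[R]_7] of_S.
Proof.
move=> k; have oU : open [set: 'rV[R]_7] by exact: openT.
have cl : continuous (@tpart R : _ -> R^o) by exact: linear_rV_continuous.
apply: (@Ck_eq _ _ _ k _ ((of_S_lin : _ -> NI) +
  (fun q => exp_derivs m 0%N (tpart q : R^o)
     *: (- (expR (- m * c) / m) *: eT)) +
  cst (m^-1 *: eT))) => //.
  by move=> q _; rewrite of_SE.
apply: Ck_add => //; last exact: Ck_cst.
apply: Ck_add => //; first exact: linear_Ck continuous_of_S_lin.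
exact: (Ck_scalar_comp (J := setT) k _ oU cl
  (fun n r _ => is_derive_exp_derivs m n r)).
Qed.

Lemma of_SK p : NI_dom p -> of_S (to_S p) = p.
Proof.
case: p => x T uT; rewrite /of_S /to_S npart_spair tpart_spair /= exp_adD.
rewrite subrr exp_ad0 subrK mulrN mulNr opprK [m * (_ / _)]mulrC mulfVK// lnK//.
by congr pair; rewrite opprB addrCA subrr addr0 mulrC mulKf.
Qed.

Lemma NI_dom_of_S q : NI_dom (of_S q).
Proof.
rewrite /NI_dom /dom /= mulrC mulfVK// opprB addrCA subrr addr0.
exact: expR_gt0.
Qed.

Lemma to_SK q : to_S (of_S q) = q.
Proof.
rewrite /of_S /to_S /= exp_adD addNr exp_ad0.
rewrite [m * _]mulrC mulfVK// opprB addrCA subrr addr0 expRK.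
rewrite -[RHS]spairK; congr spair.
by field.
Qed.

Lemma diff_to_S p v : NI_dom p ->
  'd to_S p v = spair (expad (- c) v.1) (v.2 / (1 - m * p.2)).
Proof.
move=> uT.
have dlog := is_derive_log_derivs 0 uT.
have d1 : is_diff p to_S_lin to_S_lin.
  apply: (affine_diff (b := 0)); first exact: continuous_to_S_lin.
  by move=> x; rewrite addr0.
have d2 := is_diff_scalar_comp (- m^-1 *: e7) continuous_time dlog.
have d3 := is_diff_cst (- c *: e7) p.
have [_ dE] := is_diffD (is_diffD d1 d2) d3.
have -> : to_S = (to_S_lin : NI -> 'rV[R]_7) +
  (fun p => log_derivs m 0%N (time p) *: (- m^-1 *: e7)) + cst (- c *: e7).
  by apply/funext => x; rewrite to_SE.
rewrite dE !fctE /= /to_S_lin /e7 /pow_derivs big_ord0 !spairZ !spairD.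
rewrite !scaler0 !addr0; congr spair.
rewrite mul1r subr0 powR_inv1 ?ltW// /time.
by field; rewrite m0 gt_eqF.
Qed.

(** At the image point the conformal factor is u^2. The i-th Maurer-Cartan component carries u^(a_i
    - 1), which leaves u^(2 a_i), the squared factor of f^i; the last component is dT / u, which
    leaves dT^2. *)
Lemma metric_to_S (t : 'rV[R]_7 -> R^o) p u v : (forall q, t q = c + tpart q) ->
  NI_dom p -> metric_S m a t (to_S p) ('d to_S p u) ('d to_S p v) =
  metric_NI m a (fun T => coframe_metric (coframe m a T)) p u v.
Proof.
move=> tE uT; rewrite !diff_to_S// /metric_S /metric_NI tE.
case: p uT => x T uT; rewrite /NI_dom /= in uT.
have uN : 1 - m * T != 0 by rewrite gt_eqF.
rewrite tpart_spair [c + _]addrC subrK.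
have -> : expR (- 2 * m * - (ln (1 - m * T) / m)) = (1 - m * T) ^+ 2.
  have -> : - 2 * m * - (ln (1 - m * T) / m) = ln (1 - m * T) + ln (1 - m * T).
    by field.
  by rewrite expRD lnK.
(* The [c] in the base point cancels the one in [expad (- c)], leaving the parameter ln(u) / m. *)
have thE w : theta_S m a (to_S (x, T))
   (spair (expad (- c) w.1) (w.2 / (1 - m * T))) =
   spair (expad (ln (1 - m * T) / m) (mc_N m a x w.1)) (w.2 / (1 - m * T)).
  rewrite theta_SE /mc_S !npart_spair !tpart_spair mc_N_exp_ad exp_adD /=.
  by rewrite opprB opprK addrAC subrr add0r.
rewrite !thE big_ord_recr /= !spair_last mulrDr; congr (_ + _); last first.
  by field.
rewrite /coframe_metric mulr_sumr; apply: eq_bigr => i _.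
have -> : widen_ord (leqnSn 6) i = lshift 1 i by apply/val_inj.
rewrite !spair_lshift !theta_NE /coframe !mul_mx_diag !mxE weightE.
have -> : expR (ln (1 - m * T) / m * - (m * (1 - (exponents R a)`_i))) =
  (1 - m * T) `^ ((exponents R a)`_i - 1).
  rewrite /powR (negbTE uN); congr expR.
  by field.
rewrite powRB ?uN ?implybT// powRr1 ?ltW//.
by field.
Qed.

End Isometry.

Theorem proposition6p1 (R : realType) (m : R) (hm : m != 0) (a : label)
    (t : 'rV[R]_7 -> R^o) (ht : primitive_e7 m a t) :
  exists (I : set R) (omega : R -> kform R 6 2) (psip psim : R -> kform R 6 3)
         (h : R -> 'rV[R]_6 -> 'rV[R]_6 -> R),
    [/\ [/\ open I, is_interval I & I 0],
        [/\ forall T, I T -> su3_structure (omega T) (psip T) (psim T) (h T),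
            forall M, smooth (V := R^o) I (fun T => omega T M)
          & forall M, smooth (V := R^o) I (fun T => psip T M)],
        (let e := wedge1 (1%:M : 'M[R]_6) in
         omega 0 = e [:: 1; 4]%N - e [:: 2; 3]%N + e [:: 5; 6]%N /\
         psip 0 = e [:: 1; 2; 5]%N - e [:: 3; 4; 5]%N
                  + e [:: 1; 3; 6]%N + e [:: 2; 4; 6]%N),
        (forall T, I T ->
           (forall M, ce_diff (n_bracket m a) (omega T) M
                      = derive1 (fun T' : R^o => psip T' M) T) /\
           (forall M, ce_diff (n_bracket m a) (psim T) M
                      = - wedge (omega T)
                            (fun M' => derive1 (fun T' : R^o => omega T' M') T)
                            M))
      & isometric [set p | I p.2] (metric_NI m a h)
                  [set: 'rV[R]_7] (metric_S m a t)].
Proof.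
exists (dom m), (omega m a), (psip m a), (psim m a),
  (fun T => coframe_metric (coframe m a T)); split.
- split; [exact: open_dom|exact: is_interval_dom|].
  by rewrite /dom /= mulr0 subr0.
- split=> [T IT|M|M]; first exact/su3_coframe/unitmx_coframe.
    exact: smooth_omega.
  exact: smooth_psip.
- by rewrite /omega /psip coframe0.
- by move=> T IT; split=> M; [exact: flow_psip|exact: flow_omega].
(* The value at the origin determines [t], and fixes the translation built into the isometry. *)
- pose c := t 0; have tE := primitive_e7E ht.
  exists (to_S m a c), (of_S m a c); split.
  + by split; [exact: smooth_to_S|exact: smooth_of_S].
  + by move=> p Ip; rewrite of_SK.
  + by move=> q _; rewrite to_SK //; split=> //; exact: NI_dom_of_S.
  + by move=> p u v Ip; exact: metric_to_S.
Qed.
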